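(* Let $T$ and $A$ be bounded linear operators on a complex Hilbert space $H$, and suppose that $0$ does not belong to the approximate point spectrum of $A$. Let $f\in H$ be a unit vector, and put $\lambda=\frac{(Tf,Af)}{(Af,Af)}$ and $h=Tf-\lambda Af$. Then $f$ is a stationary distance vector of the generalized eigenvalue problem $Tf=\lambda Af$ if and only if $$(T^{*}-\bar{\lambda}A^{*})(T-\lambda A)f=\|h\|^{2}f .$$
   Context: $(\cdot,\cdot)$ is the inner product of $H$ (linear in the first variable) and $\|\cdot\|$ its norm. The approximate point spectrum of $A$ is the set $\sigma_{app}A$ of approximate eigenvalues of $A$; $0\notin\sigma_{app}A$ means that there is $c>0$ with $\|Ax\|\ge c\|x\|$ for all $x\in H$. Stationary vector: let $\varphi$ be a real-valued functional on the unit sphere of $H$. A unit vector $f$ is a stationary vector of $\varphi$ if for every fixed $g\in H$ the function of a real variable $t$ (defined for $t$ near $0$) $$w_g(t)=\varphi\left(\frac{f+tg}{\|f+tg\|}\right)$$ satisfies $w_g'(0)=0$. Stationary distance vector: a unit vector $f$ is a stationary distance vector of the generalized eigenvalue problem $Tf=\lambda Af$ if it is a stationary vector of the functional $$\varphi(u)=\left\|Tu-\frac{(Tu,Au)}{(Au,Au)}Au\right\|^{2},\qquad \|u\|=1 .$$ *)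

(* Defs.v *)
From HB Require Import structures.
From mathcomp Require Import all_boot all_order all_algebra.
From mathcomp Require Import all_classical all_reals all_analysis.
From mathcomp Require Import complex sesquilinear.

Set Implicit Arguments.
Unset Strict Implicit.
Unset Printing Implicit Defensive.

Import Order.TTheory GRing.Theory Num.Theory.
Import numFieldNormedType.Exports.

Local Open Scope classical_set_scope.
Local Open Scope ring_scope.

(* The norms of [H : completeNormedModType R[i]] and of [R[i]] take values in
   the real elements of [R[i]].  The embedding of [R] into [R[i]] is
   [real_complex R], and [complex.Re] goes back to [R]. *)

(* A complex Hilbert space is a complete normed space [H] over [R[i]] with a
   positive definite form [dot : {dot H for Num.conj}], linear in its first and
   conjugate-linear in its second argument, that induces the norm of [H]. *)
Definition induces_norm (R : realType) (H : completeNormedModType R[i])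
    (dot : {dot H for Num.conj}) : Prop :=
  forall x : H, `|x| ^+ 2 = dot x x.

Definition bounded_operator (R : realType) (H : completeNormedModType R[i])
    (T : {linear H -> H}) : Prop :=
  exists M : R, forall x : H, `|T x| <= real_complex R M * `|x|.

(* For [y : H], [adjoint dot T y] is the vector [z] with (T x, y) = (x, z) for
   all [x].  It is unique because [dot] is positive definite, and it exists when
   [T] is bounded by the Riesz representation theorem; otherwise the value is
   unspecified. *)
Definition adjoint (R : realType) (H : completeNormedModType R[i])
    (dot : {dot H for Num.conj}) (T : {linear H -> H}) : H -> H :=
  fun y => get [set z : H | forall x : H, dot (T x) y = dot x z].

Definition approx_eigenvalue (R : realType) (H : completeNormedModType R[i])
    (A : {linear H -> H}) (mu : R[i]) : Prop :=
  exists x : nat -> H, (forall n, `|x n| = 1) /\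
    (fun n => A (x n) - mu *: x n) @ \oo --> (0 : H).

Definition approx_point_spectrum (R : realType) (H : completeNormedModType R[i])
    (A : {linear H -> H}) : set R[i] :=
  [set mu | approx_eigenvalue A mu].

(* [phi] matters only on the unit sphere: for a unit vector [f] the normalized
   vector below has norm 1 for all [t] near 0.  [is_derive] asserts both
   differentiability at 0 and the value of the derivative. *)
Definition stationary_vector (R : realType) (H : completeNormedModType R[i])
    (phi : H -> R) (f : H) : Prop :=
  `|f| = 1 /\
  forall g : H,
    is_derive (0 : R) (1 : R)
      (fun t : R => let v := f + real_complex R t *: g in phi (`|v|^-1 *: v))
      (0 : R).

Definition rayleigh (R : realType) (H : completeNormedModType R[i])
    (dot : {dot H for Num.conj}) (T A : {linear H -> H}) (u : H) : R[i] :=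
  dot (T u) (A u) / dot (A u) (A u).

Definition sq_distance (R : realType) (H : completeNormedModType R[i])
    (dot : {dot H for Num.conj}) (T A : {linear H -> H}) (u : H) : R :=
  complex.Re (`|T u - rayleigh dot T A u *: A u| ^+ 2).

Definition stationary_distance_vector (R : realType)
    (H : completeNormedModType R[i]) (dot : {dot H for Num.conj})
    (T A : {linear H -> H}) (f : H) : Prop :=
  stationary_vector (sq_distance dot T A) f.

Lemma approx_point_spectrum0P (R : realType) (H : completeNormedModType R[i])
    (A : {linear H -> H}) :
  ~ approx_point_spectrum A 0 <->
  exists2 c : R, 0 < c & forall x : H, real_complex R c * `|x| <= `|A x|.
Proof.
split=> [nA|[c c0 cA] [x [x1 +]]]; last first.
  move=> /cvgrPdist_lt/(_ (real_complex R c)); rewrite ltcR => /(_ c0) [N _].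
  move=> /(_ N (leqnn N)) /=; rewrite scale0r subr0 sub0r normrN.
  by have := cA (x N); rewrite x1 mulr1 => /le_lt_trans/[apply]; rewrite ltxx.
apply: contrapT => nc; apply: nA.
have ex n : exists x : H, `|x| = 1 /\ `|A x| < n.+1%:R^-1.
  apply: contrapT => nx; apply: nc; exists n.+1%:R^-1; first by rewrite invr_gt0.
  move=> x; have [->|x0] := eqVneq x 0; first by rewrite normr0 mulr0.
  have nx0 : 0 < `|x| by rewrite normr_gt0.
  rewrite fmorphV rmorph_nat.
  rewrite -ler_pdivlMr// real_leNgt ?ger0_real ?invr_ge0 ?divr_ge0//.
  apply/negP => xlt; apply: nx; exists (`|x|^-1 *: x).
  rewrite normrZ normfV normr_id mulVf ?gt_eqF//; split => //.
  by rewrite linearZ normrZ normfV normr_id mulrC.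
pose x n := projT1 (cid (ex n)).
have x1 n : `|x n| = 1 by rewrite /x; case: cid => ? [].
have Ax n : `|A (x n)| < n.+1%:R^-1 by rewrite /x; case: cid => ? [].
exists x; split => //; apply/cvgrPdist_lt => e e0.
have er : e = real_complex R (complex.Re e).
  by rewrite RRe_real// gtr0_real.
have re0 : 0 < complex.Re e by rewrite -ltcR -er.
have [N _ Ne] := near_infty_natSinv_lt (PosNum re0).
exists N => // n /= Nn; rewrite scale0r subr0 sub0r normrN.
apply: (lt_trans (Ax n)); rewrite er -(rmorph_nat (real_complex R)) -fmorphV.
by rewrite ltcR; exact: Ne.
Qed.

(* Main.v *)
(* The map v |-> ||Tv||^2 - |(Tv,Av)|^2 / ||Av||^2 is the squared distance on the
   unit sphere and is homogeneous of degree 2, so w_g(t) is this expression at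
   v = f + tg divided by ||v||^2, a rational function of t.  Its derivative at 0
   is 2 Re (((T - lam A)g, h) - ||h||^2 (g, f)), and this vanishes for all g
   exactly when the adjoint equation holds.  The adjoints exist by the Riesz
   representation theorem. *)

Require Import Defs.
From HB Require Import structures.
From mathcomp Require Import all_boot all_order all_algebra.
From mathcomp Require Import all_classical all_reals all_analysis.
From mathcomp Require Import complex sesquilinear.
From mathcomp Require Import ring lra.

Import Order.TTheory GRing.Theory Num.Theory.
Import numFieldNormedType.Exports.

Local Open Scope classical_set_scope.
Local Open Scope ring_scope.

Set Implicit Arguments.
Unset Strict Implicit.
Unset Printing Implicit Defensive.

(** * The real inner product Re (x, y) underlying the complex one *)

Definition rdot (R : realType) (H : completeNormedModType R[i])
    (dot : {dot H for Num.conj}) (x y : H) : R :=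
  complex.Re (dot x y).

Definition rnorm (R : realType) (H : completeNormedModType R[i]) (x : H) : R :=
  complex.Re `|x|.

Lemma rnormE (R : realType) (H : completeNormedModType R[i]) (x : H) :
  `|x| = real_complex R (rnorm x).
Proof. by rewrite /rnorm RRe_real// normr_real. Qed.

Lemma rnorm_ge0 (R : realType) (H : completeNormedModType R[i]) (x : H) :
  0 <= rnorm x.
Proof. by rewrite -lecR -[leRHS]rnormE rmorph0. Qed.

Lemma dotZl (R : realType) (H : completeNormedModType R[i])
    (dot : {dot H for Num.conj}) (a : R[i]) (x y : H) :
  dot (a *: x) y = a * dot x y.
Proof. exact: linearZl_LR. Qed.

Lemma dotBl (R : realType) (H : completeNormedModType R[i])
    (dot : {dot H for Num.conj}) (x y z : H) :
  dot (x - y) z = dot x z - dot y z.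
Proof. exact: linearBl. Qed.

Lemma dotBr (R : realType) (H : completeNormedModType R[i])
    (dot : {dot H for Num.conj}) (x y z : H) :
  dot x (y - z) = dot x y - dot x z.
Proof. exact: linearBr. Qed.

Lemma dotZr (R : realType) (H : completeNormedModType R[i])
    (dot : {dot H for Num.conj}) (a : R[i]) (x y : H) :
  dot x (a *: y) = a^* * dot x y.
Proof. exact: linearZr_LR. Qed.

Lemma rdotDl (R : realType) (H : completeNormedModType R[i])
    (dot : {dot H for Num.conj}) (x y z : H) :
  rdot dot (x + y) z = rdot dot x z + rdot dot y z.
Proof. by rewrite /rdot linearDl raddfD. Qed.

Lemma Re_real_complexM (R : realType) (t : R) (z : R[i]) :
  complex.Re (real_complex R t * z) = t * complex.Re z.
Proof. by case: z => a b /=; rewrite mul0r subr0. Qed.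

Lemma rdotZl (R : realType) (H : completeNormedModType R[i])
    (dot : {dot H for Num.conj}) (t : R) (x y : H) :
  rdot dot (real_complex R t *: x) y = t * rdot dot x y.
Proof. by rewrite /rdot dotZl Re_real_complexM. Qed.

Lemma dotC (R : realType) (H : completeNormedModType R[i])
    (dot : {dot H for Num.conj}) (x y : H) : dot x y = (dot y x)^*.
Proof. by rewrite hermC expr0 mul1r. Qed.

Lemma rdotC (R : realType) (H : completeNormedModType R[i])
    (dot : {dot H for Num.conj}) (x y : H) : rdot dot x y = rdot dot y x.
Proof. by rewrite /rdot dotC; case: (dot y x). Qed.

Lemma rdotDr (R : realType) (H : completeNormedModType R[i])
    (dot : {dot H for Num.conj}) (x y z : H) :
  rdot dot x (y + z) = rdot dot x y + rdot dot x z.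
Proof. by rewrite rdotC rdotDl !(rdotC dot x). Qed.

Lemma rdotZr (R : realType) (H : completeNormedModType R[i])
    (dot : {dot H for Num.conj}) (t : R) (x y : H) :
  rdot dot x (real_complex R t *: y) = t * rdot dot x y.
Proof. by rewrite rdotC rdotZl rdotC. Qed.

Lemma rdotxx (R : realType) (H : completeNormedModType R[i])
    (dot : {dot H for Num.conj}) (hdot : induces_norm dot) (x : H) :
  rdot dot x x = rnorm x ^+ 2.
Proof. by rewrite /rdot -hdot rnormE -rmorphXn. Qed.

Lemma rdot_xx_ge0 (R : realType) (H : completeNormedModType R[i])
    (dot : {dot H for Num.conj}) (hdot : induces_norm dot) (x : H) :
  0 <= rdot dot x x.
Proof. by rewrite rdotxx// sqr_ge0. Qed.

Lemma dotxx (R : realType) (H : completeNormedModType R[i])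
    (dot : {dot H for Num.conj}) (hdot : induces_norm dot) (x : H) :
  dot x x = real_complex R (rdot dot x x).
Proof. by rewrite rdotxx// -hdot rnormE rmorphXn. Qed.

(** * Cauchy-Schwarz, Riesz representation and adjoints *)

Lemma Cauchy_Schwarz_rdot (R : realType) (H : completeNormedModType R[i])
    (dot : {dot H for Num.conj}) (hdot : induces_norm dot) (x y : H) :
  `|rdot dot x y| <= rnorm x * rnorm y.
Proof.
have [y0|y0] := eqVneq (rnorm y) 0.
  have /eqP : `|y| = 0 by rewrite rnormE y0.
  rewrite normr_eq0 => /eqP ->.
  by rewrite /rdot linear0r normr0 mulr_ge0// rnorm_ge0.
have yp : 0 < rnorm y ^+ 2 by rewrite exprn_gt0// lt0r y0 rnorm_ge0.
(* This vector is ||y||^2 times the component of [x] orthogonal to [y] for [rdot]; its squared norm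
   is ||y||^2 (||x||^2 ||y||^2 - (Re (x, y))^2). *)
have := rdot_xx_ge0 hdot
  (real_complex R (rnorm y ^+ 2) *: x + real_complex R (- rdot dot x y) *: y).
rewrite !(rdotDl, rdotDr, rdotZl, rdotZr) (rdotC dot y x) !rdotxx// => ge0.
rewrite -[leRHS]ger0_norm ?mulr_ge0 ?rnorm_ge0// -[_ <= _]ler_sqr ?nnegrE//.
rewrite !real_normK ?num_real// exprMn -(ler_pM2l yp) -subr_ge0.
by apply: le_trans ge0 _; rewrite le_eqVlt; apply/orP; left; apply/eqP; ring.
Qed.

Lemma quadratic_ge0_linear_coef (R : realType) (a b : R) :
  0 <= a -> (forall t, 0 <= a * t ^+ 2 + b * t) -> b = 0.
Proof.
move=> a0 ab; have a1 : 0 < a + 1 by lra.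
(* The true minimizer -b/(2a) breaks down at [a = 0]; with [a + 1] the value is -(b/(a+1))^2 in
   every case. *)
have := ab (- b / (a + 1)).
have -> : a * (- b / (a + 1)) ^+ 2 + b * (- b / (a + 1))
          = - (b / (a + 1)) ^+ 2 by field; rewrite gt_eqF.
rewrite oppr_ge0 => h.
have /eqP : (b / (a + 1)) ^+ 2 = 0 by apply/eqP; rewrite eq_le h sqr_ge0.
rewrite expf_eq0 mulf_eq0 invr_eq0 (gt_eqF a1) orbF /=.
by move/eqP.
Qed.

Lemma riesz_representation (R : realType) (H : completeNormedModType R[i])
    (dot : {dot H for Num.conj}) (hdot : induces_norm dot)
    (l : H -> R[i]) (l_lin : scalar l)
    (C : R) (lC : forall x, `|complex.Re (l x)| <= C * rnorm x) :
  exists z, forall x, l x = dot x z.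
Proof.
(* The representing vector minimizes Phi: by the parallelogram identity a
   minimizing sequence is Cauchy, and the first variation of Phi vanishes at its
   limit. *)
pose L x := complex.Re (l x).
have LD x y : L (x + y) = L x + L y.
  by rewrite /L -{1}[x]scale1r l_lin mul1r raddfD.
have l0 : l 0 = 0.
  have := l_lin 1 0 0; rewrite scale1r addr0 mul1r => /eqP.
  by rewrite -[eqbLHS]addr0 (inj_eq (addrI _)) eq_sym => /eqP.
have lZ a x : l (a *: x) = a * l x.
  by rewrite -[a *: x]addr0 l_lin l0 addr0.
have LZ t x : L (real_complex R t *: x) = t * L x.
  by rewrite /L lZ Re_real_complexM.
(* If [z] represents [l], then [Phi x] is ||x - z||^2 - ||z||^2, so [z] is its only minimizer. *)
pose Phi x := rdot dot x x - 2 * L x.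
have Phi_ge x : - C ^+ 2 <= Phi x.
  have := lC x; rewrite -/(L x) ler_norml => /andP[_ Lx].
  rewrite /Phi (rdotxx hdot).
  by have := sqr_ge0 (rnorm x - C); nra.
have hlb : has_lbound (range Phi).
  by exists (- C ^+ 2) => _ [x _ <-].
have hinf : has_inf (range Phi) by split => //; exists (Phi 0), 0.
set m := inf (range Phi).
have m_le x : m <= Phi x by apply: ge_inf => //; exists x.
have ex n : exists x, Phi x < m + n.+1%:R^-1.
  have n0 : (0 : R) < n.+1%:R^-1 by rewrite invr_gt0.
  by have [_ [x _ <-] xm] := inf_adherent n0 hinf; exists x.
have [u uP] := choice ex.
(* The contributions of [L] cancel at the midpoint, which leaves the parallelogram identity of the
   norm. *)
have parallelogram x y : rdot dot (x - y) (x - y) =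
    2 * Phi x + 2 * Phi y - 4 * Phi (real_complex R 2^-1 *: (x + y)).
  rewrite -scaleN1r -(rmorphN1 (real_complex R)).
  rewrite /Phi !(rdotDl, rdotDr, rdotZl, rdotZr, LZ, LD) (rdotC dot y x).
  by field.
have u_near i j : rnorm (u i - u j) ^+ 2 <= 2 * i.+1%:R^-1 + 2 * j.+1%:R^-1.
  rewrite -(rdotxx hdot) parallelogram.
  have := m_le (real_complex R 2^-1 *: (u i + u j)).
  have := uP i; have := uP j.
  by move: (i.+1%:R^-1) (j.+1%:R^-1) => a b; lra.
have u_cvg : cvg (u @ \oo).
  apply/cauchy_cvgP/cauchy_ballP => e e0.
  have er : e = real_complex R (complex.Re e) by rewrite RRe_real// gtr0_real.
  set d := complex.Re e in er.
  have d0 : 0 < d by rewrite -ltcR -er.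
  (* With both reciprocals below d^2/4, the bound in [u_near] is below d^2. *)
  have d4 : 0 < d ^+ 2 / 4 by rewrite divr_gt0// exprn_gt0.
  have [N _ Ne] := near_infty_natSinv_lt (PosNum d4).
  exists ([set u n | n in [set n | (N <= n)%N]],
          [set u n | n in [set n | (N <= n)%N]]) => /=.
    by split; exists N => // n Nn /=; exists n.
  move=> [_ _] /= [[i Ni <-] [j Nj <-]].
  rewrite -ball_normE /= er rnormE ltcR.
  rewrite -[ltLHS]ger0_norm ?rnorm_ge0// -[ltRHS]ger0_norm ?ltW//.
  rewrite -ltr_sqr ?nnegrE// !real_normK ?num_real//.
  apply: le_lt_trans (u_near i j) _.
  have /= := Ne i Ni; have /= := Ne j Nj.
  by move: (i.+1%:R^-1) (j.+1%:R^-1) => a b; lra.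
pose z := lim (u @ \oo).
have uz (e : R) : 0 < e -> \forall n \near \oo, rnorm (u n - z) < e.
  move=> e0; have er0 : 0 < real_complex R e by rewrite ltcR.
  move/cvgrPdist_lt : u_cvg => /(_ _ er0).
  apply: filterS => n; rewrite distrC rnormE ltcR; exact.
have variation x : rdot dot z x = L x.
  apply/eqP; rewrite -subr_eq0; apply/eqP.
  have xx0 : 0 <= rdot dot x x by exact: rdot_xx_ge0.
  suff : 2 * (rdot dot z x - L x) = 0 by lra.
  apply: quadratic_ge0_linear_coef xx0 _ => t.
  (* Comparing [Phi (u n + t x) >= m] with [Phi (u n) < m + 1/(n+1)] gives the inequality at [u n]
     up to 1/(n+1); replacing [u n] by [z] costs a second small error. Each error takes e/2. *)
  apply/ler_addgt0Pr => e e0.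
  (* Chosen so that |t| ||u n - z|| ||x|| <= e/4; the [+ 1] keeps the denominator positive when [t]
     or [x] is 0. *)
  have e1 : 0 < e / 2 / (2 * (`|t| * rnorm x) + 1).
    by rewrite !divr_gt0// ltr_wpDl// !mulr_ge0// rnorm_ge0.
  have e2 : 0 < e / 2 by lra.
  near \oo => n.
  have un1 : rnorm (u n - z) < e / 2 / (2 * (`|t| * rnorm x) + 1).
    by near: n; exact: uz.
  have un2 : n.+1%:R^-1 < e / 2.
    by near: n; exact: (near_infty_natSinv_lt (PosNum e2)).
  have := m_le (u n + real_complex R t *: x); have := uP n.
  rewrite /Phi !(rdotDl, rdotDr, rdotZl, rdotZr, LZ, LD) (rdotC dot x (u n)).
  have -> : rdot dot (u n) x = rdot dot z x + rdot dot (u n - z) x.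
    by rewrite -rdotDl addrC subrK.
  have : t * rdot dot (u n - z) x <= e / 2 / 2.
    apply: le_trans (ler_norm _) _; rewrite normrM.
    have := Cauchy_Schwarz_rdot hdot (u n - z) x.
    move=> /(ler_wpM2l (normr_ge0 t)) /le_trans; apply.
    move: un1; rewrite ltr_pdivlMr; last first.
      by rewrite ltr_wpDl// !mulr_ge0// rnorm_ge0.
    by have := rnorm_ge0 (u n - z); lra.
  by move: un2; move: (n.+1%:R^-1) => a; lra.
exists z => x; apply/eqP; rewrite eq_complex.
have re y : complex.Re (l y) = complex.Re (dot y z).
  by rewrite -/(L y) -variation rdotC.
rewrite re eqxx /=.
(* Since Re (i w) = - Im w, agreement of real parts at i x is agreement of imaginary parts at
   [x]. *)
have := re ('i%C *: x); rewrite lZ dotZl !(mulrC 'i%C) !ReiNIm.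
by move/oppr_inj => ->.
Unshelve. all: by end_near.
Qed.

(** By Cauchy-Schwarz, u |-> (T u, y) is bounded with constant M ||y||, so Riesz provides a vector
    for [get] to pick. *)
Lemma adjointP (R : realType) (H : completeNormedModType R[i])
    (dot : {dot H for Num.conj}) (hdot : induces_norm dot)
    (T : {linear H -> H}) (hT : bounded_operator T) (x y : H) :
  dot (T x) y = dot x (adjoint dot T y).
Proof.
have [M TM] := hT.
suff [z zP] : exists z, forall x, dot (T x) y = dot x z.
  exact: (@getPex _ [set z : H | forall x : H, dot (T x) y = dot x z]
            (ex_intro _ z zP)).
apply: (@riesz_representation _ _ _ hdot (fun u => dot (T u) y) _
          (M * rnorm y)) => [a u v|u].
  by rewrite linearP linearPl.
apply: le_trans (Cauchy_Schwarz_rdot hdot _ _) _.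
rewrite mulrAC ler_wpM2r ?rnorm_ge0//.
by have := TM u; rewrite !rnormE -rmorphM lecR.
Qed.

(** * Multiplication by i, and the squared distance in real terms *)

Lemma rdotir (R : realType) (H : completeNormedModType R[i])
    (dot : {dot H for Num.conj}) (x y : H) :
  rdot dot x ('i%C *: y) = - rdot dot ('i%C *: x) y.
Proof.
rewrite rdotC /rdot !dotZl !(mulrC 'i%C) !ReiNIm dotC.
by case: (dot x y) => a b /=; rewrite opprK.
Qed.

Lemma rdotii (R : realType) (H : completeNormedModType R[i])
    (dot : {dot H for Num.conj}) (x y : H) :
  rdot dot ('i%C *: x) ('i%C *: y) = rdot dot x y.
Proof.
rewrite rdotir scalerA -expr2 complexiE Num.sqrCi scaleN1r.
by rewrite /rdot linearNl raddfN opprK.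
Qed.

(* [rdot dot ('i%C *: x) y] is - Im (x, y).  The formula also holds when
   [A u = 0], since the quotients are then 0. *)
Lemma sq_distanceE (R : realType) (H : completeNormedModType R[i])
    (dot : {dot H for Num.conj}) (hdot : induces_norm dot)
    (T A : {linear H -> H}) (u : H) :
  sq_distance dot T A u = rdot dot (T u) (T u) -
    (rdot dot (T u) (A u) ^+ 2 + rdot dot ('i%C *: T u) (A u) ^+ 2)
      / rdot dot (A u) (A u).
Proof.
rewrite /sq_distance /rayleigh hdot.
set x := T u; set y := A u; set w := x - _.
(* [rayleigh] is the coefficient of the projection of [x] on [y], so the residual [w] is orthogonal
   to [y] and (w, w) = (w, x). *)
have wy : dot w y = 0.
  rewrite dotBl dotZl /=.
  have [->|y0] := eqVneq y 0; first by rewrite !linear0r ?(mulr0, mul0r) subr0.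
  have yy0 : dot y y != 0 by rewrite -hdot expf_neq0// normr_eq0.
  by rewrite divfK// subrr.
have -> : dot w w = dot x x - dot x y * dot y x / dot y y.
  rewrite {2}/w dotBr dotZr /= wy mulr0 subr0.
  by rewrite dotBl dotZl mulrAC.
rewrite raddfB /=; congr (_ - _).
rewrite (dotC dot y x) (dotxx hdot y) -fmorphV mulrC Re_real_complexM mulrC.
congr (_ / _); rewrite -sqr_normc -add_Re2_Im2 /=.
by rewrite /rdot dotZl (mulrC 'i%C) ReiNIm sqrrN.
Qed.

Lemma sq_distanceZ (R : realType) (H : completeNormedModType R[i])
    (dot : {dot H for Num.conj}) (hdot : induces_norm dot)
    (T A : {linear H -> H}) (c : R) (u : H) :
  sq_distance dot T A (real_complex R c *: u) = c ^+ 2 * sq_distance dot T A u.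
Proof.
rewrite !sq_distanceE// !(linearZ_LR T) !(linearZ_LR A) /=.
rewrite scalerA (mulrC 'i%C) -scalerA.
rewrite !(rdotZl, rdotZr).
(* The two degenerate cases rely on 0^-1 = 0; [field] handles nonzero denominators only. *)
have [->|c0] := eqVneq c 0.
  by rewrite !mul0r expr0n /= !(addr0, mul0r) subr0.
have [->|q0] := eqVneq (rdot dot (A u) (A u)) 0.
  by rewrite !mulr0 !invr0 !mulr0 !subr0 mulrA.
by field; rewrite c0 q0.
Qed.

(** * Derivatives at 0 along the line f + t g *)

Lemma is_derive_affine (R : realType) (a b : R) :
  is_derive (0 : R) (1 : R) (fun t : R => a + t * b) b.
Proof.
have := is_deriveD (is_derive_cst a (0 : R) (1 : R))
  (is_deriveM (is_derive_id (0 : R) (1 : R)) (is_derive_cst b (0 : R) (1 : R))).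
by move/is_derive_eq; apply; rewrite /= scale0r !add0r scaler1.
Qed.

Lemma is_derive_rdot (R : realType) (H : completeNormedModType R[i])
    (dot : {dot H for Num.conj}) (x x' y y' : H) :
  is_derive (0 : R) (1 : R)
    (fun t : R => rdot dot (x + real_complex R t *: x')
                           (y + real_complex R t *: y'))
    (rdot dot x' y + rdot dot x y').
Proof.
rewrite (_ : (fun t => _) = (fun t => (rdot dot x y + t * rdot dot x' y) +
    t * (rdot dot x y' + t * rdot dot x' y'))); last first.
  by apply/funext => t; rewrite !(rdotDl, rdotDr, rdotZl, rdotZr); ring.
have := is_deriveD (is_derive_affine (rdot dot x y) (rdot dot x' y))
  (is_deriveM (is_derive_id (0 : R) (1 : R))
     (is_derive_affine (rdot dot x y') (rdot dot x' y'))).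
move/is_derive_eq; apply.
by rewrite /= mul0r addr0 scale0r add0r scaler1.
Qed.

(** At v = f + t g the roles are: [P] = ||Tv||^2, [X] and [Y] = Re and -Im of (Tv, Av), [Q] =
    ||Av||^2, [S] = ||v||^2. [S 0 = 1] because [f] is a unit vector. *)
Lemma is_derive_quotients (R : realType) (P X Y Q S : R -> R)
    (dP dX dY dQ dS : R) :
  is_derive (0 : R) (1 : R) P dP -> is_derive (0 : R) (1 : R) X dX ->
  is_derive (0 : R) (1 : R) Y dY -> is_derive (0 : R) (1 : R) Q dQ ->
  is_derive (0 : R) (1 : R) S dS -> Q 0 != 0 -> S 0 = 1 ->
  is_derive (0 : R) (1 : R)
    (fun t => (P t - (X t ^+ 2 + Y t ^+ 2) / Q t) / S t)
    (dP - 2 * (X 0 * dX + Y 0 * dY) / Q 0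
     + (X 0 ^+ 2 + Y 0 ^+ 2) / Q 0 ^+ 2 * dQ
     - (P 0 - (X 0 ^+ 2 + Y 0 ^+ 2) / Q 0) * dS).
Proof.
move=> Pd Xd Yd Qd Sd Q0 S0.
have S0' : S 0 != 0 by rewrite S0 oner_neq0.
have := is_deriveM
  (is_deriveB Pd
    (is_deriveM (is_deriveD (is_deriveX 2 Xd) (is_deriveX 2 Yd))
      (is_deriveV Q0 Qd)))
  (is_deriveV S0' Sd).
move/is_derive_eq; apply.
rewrite !fctE /= S0 /GRing.scale /=.
by field.
Qed.

(* No hypothesis [v != 0]: both sides are 0 at [v = 0] because [0^-1 = 0]. *)
Lemma sq_distance_normalized (R : realType) (H : completeNormedModType R[i])
    (dot : {dot H for Num.conj}) (hdot : induces_norm dot)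
    (T A : {linear H -> H}) (v : H) :
  sq_distance dot T A (`|v|^-1 *: v) = sq_distance dot T A v / rdot dot v v.
Proof.
by rewrite rnormE -fmorphV sq_distanceZ// exprVn -(rdotxx hdot) mulrC.
Qed.

Lemma scale_ReIm (R : realType) (H : completeNormedModType R[i])
    (z : R[i]) (x : H) :
  z *: x = real_complex R (complex.Re z) *: x
           + real_complex R (complex.Im z) *: ('i%C *: x).
Proof. by rewrite {1}[z]complexE scalerDl [in RHS]scalerA (mulrC 'i%C). Qed.

(** The numerator has value ||h||^2 and derivative 2 Re ((T - lam A)g, h) at 0: [h] is orthogonal to
    [A f], so the variation of the quotient [lam] has no first-order effect. The denominator ||v||^2
    has value 1 and derivative 2 Re (g, f). *)
Lemma is_derive_sq_distance (R : realType) (H : completeNormedModType R[i])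
    (dot : {dot H for Num.conj}) (hdot : induces_norm dot)
    (T A : {linear H -> H}) (f g : H) (hf : `|f| = 1) (Af0 : A f != 0) :
  let lam := rayleigh dot T A f in
  let h := T f - lam *: A f in
  is_derive (0 : R) (1 : R)
    (fun t : R => let v := f + real_complex R t *: g in
       sq_distance dot T A (`|v|^-1 *: v))
    (2 * (rdot dot (T g - lam *: A g) h - rdot dot h h * rdot dot g f)).
Proof.
move=> lam h.
have hE : rdot dot h h = sq_distance dot T A f by rewrite /sq_distance hdot.
have Q0 : rdot dot (A f) (A f) != 0.
  rewrite rdotxx// expf_neq0//; apply: contra Af0 => /eqP Af0.
  by rewrite -normr_eq0 rnormE Af0.
have S0 : rdot dot f f = 1.
  rewrite rdotxx// (_ : rnorm f = 1) ?expr1n//.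
  by rewrite /rnorm hf.
(* Homogeneity removes the normalization, and linearity makes both arguments of each inner product
   affine in [t]. *)
rewrite (_ : (fun t : R => _) = fun t : R =>
  (rdot dot (T f + real_complex R t *: T g) (T f + real_complex R t *: T g)
   - (rdot dot (T f + real_complex R t *: T g)
               (A f + real_complex R t *: A g) ^+ 2
     + rdot dot ('i%C *: T f + real_complex R t *: ('i%C *: T g))
               (A f + real_complex R t *: A g) ^+ 2)
     / rdot dot (A f + real_complex R t *: A g) (A f + real_complex R t *: A g))
  / rdot dot (f + real_complex R t *: g) (f + real_complex R t *: g));
  last first.
  apply/funext => t /=; rewrite sq_distance_normalized// sq_distanceE//.
  rewrite !(linearD T) !(linearD A) !(linearZ_LR T) !(linearZ_LR A) /=.
  by rewrite scalerDr !scalerA (mulrC 'i%C).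
have at0 x y : x + real_complex R 0 *: y = x :> H.
  by rewrite rmorph0 scale0r addr0.
have := @is_derive_quotients _ _ _ _ _ _ _ _ _ _ _
  (is_derive_rdot dot (T f) (T g) (T f) (T g))
  (is_derive_rdot dot (T f) (T g) (A f) (A g))
  (is_derive_rdot dot ('i%C *: T f) ('i%C *: T g) (A f) (A g))
  (is_derive_rdot dot (A f) (A g) (A f) (A g))
  (is_derive_rdot dot f g f g).
rewrite !at0 => /(_ Q0 S0)/is_derive_eq; apply.
rewrite hE sq_distanceE// /h.
(* Splitting [lam] into real and imaginary parts leaves only real scalars, which [rdot] lets
   through. *)
rewrite (scale_ReIm lam (A f)) (scale_ReIm lam (A g)).
have -> : complex.Re lam = rdot dot (T f) (A f) / rdot dot (A f) (A f).
  by rewrite /lam /rayleigh (dotxx hdot (A f)) -fmorphV mulrC Re_real_complexM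
    mulrC.
have -> : complex.Im lam
    = - rdot dot ('i%C *: T f) (A f) / rdot dot (A f) (A f).
  rewrite /lam /rayleigh (dotxx hdot (A f)) -fmorphV.
  rewrite /(rdot dot ('i%C *: _)) dotZl (mulrC 'i%C) ReiNIm opprK.
  by case: (dot (T f) (A f)) => a b /=; rewrite mulr0 add0r.
have opp x y : rdot dot x (- y) = - rdot dot x y.
  by rewrite /rdot linearNr raddfN.
have opl x y : rdot dot (- x) y = - rdot dot x y.
  by rewrite rdotC opp rdotC.
rewrite !(rdotDl, opl, rdotZl) !(rdotDr, opp, rdotZr) !(rdotii, rdotir).
(* Symmetry brings equal inner products to one form, so that [field] sees them as the same atom. *)
rewrite (rdotC dot (T f) (T g)) (rdotC dot (A f) (A g)) (rdotC dot (A g) (T f)).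
rewrite (rdotC dot f g) (rdotC dot ('i%C *: A g) (T f)) rdotir.
set q := rdot dot (A f) (A f) in Q0 *.
by field.
Qed.

(** * From vanishing derivatives to the adjoint equation and back *)

Lemma rdot_inj (R : realType) (H : completeNormedModType R[i])
    (dot : {dot H for Num.conj}) (hdot : induces_norm dot) (x y : H) :
  (forall g, rdot dot g x = rdot dot g y) -> x = y.
Proof.
move=> xy; apply/eqP; rewrite -subr_eq0 -normr_eq0 -sqrf_eq0 hdot dotxx//.
(* Real parts suffice because the test vector [x - y] yields ||x - y||^2, which is real. *)
by have := xy (x - y); rewrite /rdot dotBr raddfB /= => ->; rewrite subrr.
Qed.

Theorem theorem1 (R : realType) (H : completeNormedModType R[i])
    (dot : {dot H for Num.conj}) (hdot : induces_norm dot)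
    (T A : {linear H -> H})
    (hT : bounded_operator T) (hA : bounded_operator A)
    (hA0 : ~ approx_point_spectrum A 0)
    (f : H) (hf : `|f| = 1) :
  let lam := dot (T f) (A f) / dot (A f) (A f) in
  let h := T f - lam *: A f in
  stationary_distance_vector dot T A f <->
  (adjoint dot T \- lam^* \*: adjoint dot A) ((T \- lam \*: A) f)
    = `|h| ^+ 2 *: f.
Proof.
move=> lam h.
have Af0 : A f != 0.
  have [c c0 cA] := (approx_point_spectrum0P A).1 hA0.
  by rewrite -normr_gt0 (lt_le_trans _ (cA f))// hf mulr1 ltcR.
have dw g : is_derive (0 : R) (1 : R)
    (fun t : R => let v := f + real_complex R t *: g in
       sq_distance dot T A (`|v|^-1 *: v))
    (2 * (rdot dot (T g - lam *: A g) h - rdot dot h h * rdot dot g f)).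
  exact: (is_derive_sq_distance hdot T g hf Af0).
(* Conjugate linearity in the second argument turns [lam^*] back into [lam] as the adjoints move
   over to [g]. *)
have lhsE g : rdot dot g ((adjoint dot T \- lam^* \*: adjoint dot A)
    ((T \- lam \*: A) f)) = rdot dot (T g - lam *: A g) h.
  rewrite /rdot /= -/h dotBr dotZr conjCK dotBl dotZl.
  by rewrite -!adjointP.
have rhsE g : rdot dot g (`|h| ^+ 2 *: f) = rdot dot h h * rdot dot g f.
  by rewrite hdot dotxx// rdotZr.
split=> [[_ st]|eqf].
  apply: (rdot_inj hdot) => g; rewrite lhsE rhsE.
  (* Uniqueness of the derivative equates the value in [dw] with the 0 of stationarity. *)
  have := @derive_val _ _ _ _ _ _ _ (dw g).
  rewrite (@derive_val _ _ _ _ _ _ _ (st g)) => /esym/eqP.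
  by rewrite mulf_eq0 pnatr_eq0 /= subr_eq0 => /eqP.
split=> // g.
have := dw g; rewrite -lhsE eqf rhsE subrr mulr0; exact.
Qed.
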